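(* Let $n\ge1$ and let $$D(n)=\{(I,J)\ |\ I,J\subset\{1,\dots,n\},\ |I|=|J|,\ I\cap J=\emptyset,\ \min(I\cup J)\in I\}$$ (in particular $I,J\neq\emptyset$). The fundamental hyperplane arrangement of the $(n-1)$-dimensional permutahedron in $\mathbb{R}^n$ is the set of hyperplanes defined by $$\sum_{i\in I}x_i=\sum_{j\in J}x_j\qquad\text{for all }(I,J)\in D(n).$$
   Context: The $(n-1)$-dimensional permutahedron in $\mathbb{R}^n$ is the convex hull of the points $(\sigma(1),\dots,\sigma(n))$ for all permutations $\sigma$ of $\{1,\dots,n\}$. For a polytope $P\subset\mathbb{R}^n$ and $z\in P$ put $\rho_zP=2z-P$ (the reflection of $P$ through $z$). The fundamental hyperplane arrangement of $P$ is the collection of all linear hyperplanes of $\mathbb{R}^n$ orthogonal to the direction of an edge of $P\cap\rho_zP$, for some $z\in P$. *)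

(* Defs.v *)
From mathcomp Require Import all_boot all_order all_algebra perm.
From mathcomp Require Import boolp classical_sets reals convex.

Set Implicit Arguments.
Unset Strict Implicit.
Unset Printing Implicit Defensive.

Import Order.TTheory GRing.Theory Num.Theory.

Local Open Scope classical_set_scope.
Local Open Scope ring_scope.

Definition dotv (R : realType) (n : nat) (x y : 'rV[R]_n) : R :=
  \sum_(i < n) x 0 i * y 0 i.

Definition convex_hull (R : realType) (n : nat) (A : set 'rV[R]_n) :
    set 'rV[R]_n :=
  smallest (@convex_set R 'rV[R]_n) A.

(* 'S_n permutes {0, ..., n-1}, whence the successor on the values. *)
Definition permutahedron (R : realType) (n : nat) : set 'rV[R]_n :=
  convex_hull [set \row_i (s i).+1%:R | s in [set: 'S_n]].
Arguments permutahedron : clear implicits.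

Definition reflection (R : realType) (n : nat) (z : 'rV[R]_n)
    (P : set 'rV[R]_n) : set 'rV[R]_n :=
  [set 2 *: z - x | x in P].

(* The faces of a polytope Q are the loci where a linear functional is maximal
   on Q; the zero functional gives Q itself. *)
Definition is_face (R : realType) (n : nat) (Q F : set 'rV[R]_n) : Prop :=
  exists c : 'rV[R]_n,
    F = [set x | Q x /\ forall y, Q y -> dotv c y <= dotv c x].

(* L is the direction of the affine hull of F: the linear span of the
   differences of points of F. *)
Definition is_direction (R : realType) (n : nat) (F : set 'rV[R]_n)
    (L : {vspace 'rV[R]_n}) : Prop :=
  (forall x y, F x -> F y -> x - y \in L) /\
  (forall M : {vspace 'rV[R]_n},
     (forall x y, F x -> F y -> x - y \in M) -> (L <= M)%VS).

Definition is_edge (R : realType) (n : nat) (Q F : set 'rV[R]_n) : Prop :=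
  is_face Q F /\ exists2 L, is_direction F L & \dim L = 1%N.

Definition orthogonal_space (R : realType) (n : nat)
    (L : {vspace 'rV[R]_n}) : set 'rV[R]_n :=
  [set x | forall d, d \in L -> dotv d x = 0].

Definition fundamental_arrangement (R : realType) (n : nat)
    (P : set 'rV[R]_n) : set (set 'rV[R]_n) :=
  [set H | exists (z : 'rV[R]_n) (F : set 'rV[R]_n) (L : {vspace 'rV[R]_n}),
    [/\ P z, is_edge (P `&` reflection z P) F, is_direction F L
      & H = orthogonal_space L]].

(* The existential i is min (I U J); with I and J empty it does not exist. *)
Definition D (n : nat) : set ({set 'I_n} * {set 'I_n}) :=
  [set IJ : {set 'I_n} * {set 'I_n} |
    [/\ #|IJ.1| = #|IJ.2|, IJ.1 :&: IJ.2 = finset.set0 &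
      exists2 i, i \in IJ.1 & forall k, k \in IJ.1 :|: IJ.2 -> (i <= k)%N]].
Arguments D : clear implicits.

Lemma D_neq0 (n : nat) (I J : {set 'I_n}) :
  D n (I, J) -> I != finset.set0 /\ J != finset.set0.
Proof.
move=> [/= IJ _ [i iI _]].
have I0 : (0 < #|I|)%N by apply/card_gt0P; exists i.
by rewrite -!card_gt0 -IJ.
Qed.

Definition balance_hyperplane (R : realType) (n : nat) (I J : {set 'I_n}) :
    set 'rV[R]_n :=
  [set x | \sum_(i in I) x 0 i = \sum_(j in J) x 0 j].
Arguments balance_hyperplane R {n} I J.

(* Main.v *)
(* The bounds 2 x(S) >= |S|(|S| + 1) hold on the permutahedron P, and the bound
   of S is tight at x as soon as no exchange e_a - e_b (a outside S, b in S) is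
   feasible at x. Hence, if x is the midpoint of two points p, q of an edge of
   Q = P \cap (2z - P), every i with (p - q)_i > 0 can be exchanged both ways
   at x with some j such that (p - q)_j < 0, and conversely at 2z - x.
   Alternating the two gives a cycle, i.e. disjoint I and J of the same size
   such that 1_I - 1_J is feasible both ways in Q at x, and so spans the
   direction of the edge.

   Conversely, for I = {i_1, ..., i_k} and J = {j_1, ..., j_k}, let sigma number
   the indices consecutively as i_1, j_1, ..., i_k, j_k, (the rest), let tau
   number them as j_1, i_2, ..., j_k, i_1, (the rest), and let
   z = (sigma + tau) / 2. Swapping all the pairs of sigma, or all those of tau,
   moves by 1_I - 1_J or its opposite, and the bounds tight along both moves
   leave only that line. *)
Require Import Defs.
From mathcomp Require Import all_boot all_order all_algebra perm.
From mathcomp Require Import boolp classical_sets reals convex.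
From mathcomp Require Import interval_inference ring lra.

Set Implicit Arguments.
Unset Strict Implicit.
Unset Printing Implicit Defensive.

Import Order.TTheory GRing.Theory Num.Theory.

Local Open Scope classical_set_scope.
Local Open Scope ring_scope.

(** * Convex sets and their feasible directions *)

Section ConvexSets.
Variables (R : realType) (n : nat).
Implicit Types (K : set 'rV[R]_n) (x y v w : 'rV[R]_n).

Lemma convex_setP K : @convex_set R 'rV[R]_n K <->
  forall x y (t : R), K x -> K y -> 0 <= t -> t <= 1 ->
    K (t *: x + (1 - t) *: y).
Proof.
split=> [cK x y t Kx Ky t0 t1|cK x y t /set_mem Kx /set_mem Ky].
  exact/set_mem/(cK x y (Itv01 t0 t1) (mem_set Kx) (mem_set Ky)).
by apply/mem_set; apply: cK.
Qed.

Definition feasible K x v := exists2 e : R, 0 < e & K (x + e *: v).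

Lemma feasible_le K x v : @convex_set R 'rV[R]_n K -> K x -> feasible K x v ->
  exists2 e : R, 0 < e & forall t, 0 <= t -> t <= e -> K (x + t *: v).
Proof.
move=> /convex_setP cK Kx [e e0 Ke]; exists e => // t t0 te.
have -> : x + t *: v = (t / e) *: (x + e *: v) + (1 - t / e) *: x.
  by apply/rowP => i; rewrite !mxE; field; rewrite gt_eqF.
by apply: cK => //; [rewrite divr_ge0// ltW|rewrite ler_pdivrMr// mul1r].
Qed.

Lemma feasible0 K x : K x -> feasible K x 0.
Proof. by move=> Kx; exists 1; rewrite ?ltr01// scaler0 addr0. Qed.

(** With a common step [m] for both directions, the midpoint of [x + m *: v] and [x + m *: w] is a
    step of length [m / 2] along [v + w]. *)
Lemma feasibleD K x v w : @convex_set R 'rV[R]_n K -> K x ->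
  feasible K x v -> feasible K x w -> feasible K x (v + w).
Proof.
move=> cK Kx /(feasible_le cK Kx)[e e0 Ke] /(feasible_le cK Kx)[f f0 Kf].
move/convex_setP : cK => cK.
pose m := Num.min e f.
have m0 : 0 < m by rewrite lt_min e0.
exists (m / 2); first by rewrite divr_gt0.
have -> : x + (m / 2) *: (v + w) =
    2^-1 *: (x + m *: v) + (1 - 2^-1) *: (x + m *: w).
  by apply/rowP => i; rewrite !mxE; field.
by apply: cK; [apply: Ke|apply: Kf|lra|lra];
  rewrite ?(ltW m0)// /m ge_min lexx ?orbT.
Qed.

Lemma feasible_sum K x (I : finType) (A : {set I}) (v : I -> 'rV[R]_n) :
  @convex_set R 'rV[R]_n K -> K x ->
  (forall i, i \in A -> feasible K x (v i)) ->
  feasible K x (\sum_(i in A) v i).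
Proof.
move=> cK Kx Av; apply: (big_ind (feasible K x)) => //.
  exact: feasible0.
by move=> *; apply: feasibleD.
Qed.

Lemma convex_hull_convex K : @convex_set R 'rV[R]_n (convex_hull K).
Proof.
apply/convex_setP => x y t Kx Ky t0 t1 B [cB KB].
by move/convex_setP : (cB) => cB'; apply: cB' => //; [apply: Kx|apply: Ky].
Qed.

Lemma convex_hull_ind K (A : set 'rV[R]_n) :
  @convex_set R 'rV[R]_n A -> K `<=` A -> convex_hull K `<=` A.
Proof. exact: smallest_sub. Qed.

End ConvexSets.

(** * Tight bounds, exchanges and balance vectors on the permutahedron *)

Section Permutahedron.
Variables (R : realType) (n : nat).
Implicit Types (x y v : 'rV[R]_n) (S : {set 'I_n}) (s : 'S_n).
Local Notation P := (permutahedron R n).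

Definition coord_sum S x : R := \sum_(i in S) x 0 i.

Lemma coord_sumD S x y : coord_sum S (x + y) = coord_sum S x + coord_sum S y.
Proof. by rewrite -big_split; apply: eq_bigr => i _; rewrite mxE. Qed.

Lemma coord_sumZ S a x : coord_sum S (a *: x) = a * coord_sum S x.
Proof. by rewrite mulr_sumr; apply: eq_bigr => i _; rewrite mxE. Qed.

Lemma coord_sumB S x y : coord_sum S (x - y) = coord_sum S x - coord_sum S y.
Proof. by rewrite -scaleN1r coord_sumD coord_sumZ mulN1r. Qed.

Definition perm_vertex s : 'rV[R]_n := \row_i (s i).+1%:R.

Lemma permutahedron_convex : @convex_set R 'rV[R]_n P.
Proof. exact: convex_hull_convex. Qed.

Lemma perm_vertexP s : P (perm_vertex s).
Proof. by move=> A [_]; apply; exists s. Qed.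

Lemma permutahedron_ind (A : set 'rV[R]_n) :
  @convex_set R 'rV[R]_n A -> (forall s, A (perm_vertex s)) -> P `<=` A.
Proof.
by move=> cA As; apply: (convex_hull_ind cA) => _ [s _ <-]; apply: As.
Qed.

Lemma perm_succE s i : (s i).+1 = (\sum_j (s j <= s i))%N.
Proof.
rewrite (reindex_inj (@perm_inj _ s^-1%g)) /=.
rewrite -[LHS]muln1 -[in LHS](card_ord (s i).+1) -sum_nat_const.
rewrite (big_ord_widen _ (fun=> 1%N) (ltn_ord (s i))) big_mkcond.
by apply: eq_bigr => j _; rewrite permKV ltnS; case: leqP.
Qed.

(* Write s i + 1 as the number of j with s j <= s i; by symmetry the pairs
   inside S contribute |S|(|S| + 1)/2, and the others are the inversions
   between S and its complement. *)
Lemma perm_sumE s S :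
  (2 * \sum_(i in S) (s i).+1 = #|S| * #|S|.+1 +
   2 * \sum_(i in S) \sum_(j in ~: S) (s j < s i))%N.
Proof.
pose h i j : nat := (s j <= s i)%N.
have sE i : i \in S ->
    (s i).+1 = (\sum_(j in S) h i j + \sum_(j in ~: S) (s j < s i))%N.
  move=> iS; rewrite perm_succE (bigID (mem S))/=; congr (_ + _)%N.
  apply: eq_big => j; rewrite ?inE// => jS.
  rewrite leq_eqVlt; case: eqP => // /val_inj/perm_inj ji.
  by rewrite ji iS in jS.
rewrite (eq_bigr _ sE) big_split mulnDr; congr (_ + _)%N.
rewrite mul2n -addnn {2}exchange_big -big_split/= -sum_nat_const.
apply: eq_bigr => i iS; rewrite -big_split/= /h.
rewrite (bigD1 i)//= leqnn (cardsD1 i) iS -addSnnS; congr (_ + _)%N.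
rewrite -sum1_card; apply: eq_big => [j|j /andP[_ ji]].
  by rewrite !inE andbC.
by case: ltngtP => // /val_inj/perm_inj ij; rewrite ij eqxx in ji.
Qed.

Lemma vertex_sum_ge s S :
  (#|S| * #|S|.+1)%:R <= 2 * coord_sum S (perm_vertex s).
Proof.
rewrite /coord_sum (eq_bigr (fun i => (s i).+1%:R)); last first.
  by move=> i _; rewrite mxE.
by rewrite -natr_sum -natrM ler_nat perm_sumE leq_addr.
Qed.

(** Equality in the bound of [coord_sum_ge]; both sides are doubled to keep the triangular number
    free of division. *)
Definition tight S x := 2 * coord_sum S x = (#|S| * #|S|.+1)%:R.

Lemma vertex_tight s S :
  (forall i j, i \in S -> j \notin S -> (s i < s j)%N) ->
  tight S (perm_vertex s).
Proof.
move=> lt_s; rewrite /tight /coord_sum.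
rewrite (eq_bigr (fun i => (s i).+1%:R)) => [|i _]; last by rewrite mxE.
rewrite -natr_sum -natrM perm_sumE big1 ?muln0 ?addn0// => i iS.
rewrite big1// => j; rewrite inE => jS.
by rewrite ltnNge (ltnW (lt_s _ _ iS jS)).
Qed.

Lemma coord_sum_ge x S : P x -> (#|S| * #|S|.+1)%:R <= 2 * coord_sum S x.
Proof.
move: x; apply: permutahedron_ind => [|s]; last exact: vertex_sum_ge.
apply/convex_setP => x y t /= hx hy t0 t1.
rewrite coord_sumD !coord_sumZ mulrDr !(mulrCA 2).
have := ler_wpM2l t0 hx; have := ler_wpM2l (_ : 0 <= 1 - t) hy; lra.
Qed.

(** Transposing the values at [i] and [j] leads to another vertex, which differs by a positive
    multiple of the exchange. *)
Lemma vertex_feasible s i j : (s i < s j)%N ->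
  feasible P (perm_vertex s) (delta_mx 0 i - delta_mx 0 j).
Proof.
move=> ij; exists ((s j)%:R - (s i)%:R); first by rewrite subr_gt0 ltr_nat.
suff -> : perm_vertex s + ((s j)%:R - (s i)%:R) *: (delta_mx 0 i - delta_mx 0 j)
  = perm_vertex (tperm i j * s) by exact: perm_vertexP.
have ij' : i != j by apply: contraTneq ij => ->; rewrite ltnn.
apply/rowP => k; rewrite !mxE permM eqxx/= -!natr1.
by case: tpermP => [->|->|/eqP/negPf -> /eqP/negPf ->];
  rewrite ?eqxx ?(negPf ij') 1?eq_sym ?(negPf ij')/=; ring.
Qed.

(** The property holds at vertices, where the absence of exchanges means that [S] carries the
    smallest values. It passes to convex combinations: an exchange feasible at an endpoint of
    positive weight stays feasible at the combination, and tightness is an affine condition. *)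
Lemma feasible_tight x S : P x ->
  (forall i j, i \notin S -> j \in S ->
     ~ feasible P x (delta_mx 0 i - delta_mx 0 j)) ->
  tight S x.
Proof.
pose A := [set x | P x /\ ((forall i j, i \notin S -> j \in S ->
  ~ feasible P x (delta_mx 0 i - delta_mx 0 j)) -> tight S x)].
suff: P `<=` A by move=> PA /PA[].
apply: permutahedron_ind => [|s].
  apply/convex_setP => {}x y t [Px Ax] [Py Ay] t0 t1; split.
    by have /convex_setP cP := permutahedron_convex; apply: cP.
  (* An endpoint of weight 0 need not pass its exchanges on, so [t = 0] and [t = 1] are settled
     first. *)
  move: t0 t1; rewrite !le_eqVlt => /orP[/eqP <-|t0].
    by rewrite scale0r add0r subr0 scale1r.
  move=> /orP[/eqP ->|t1].
    by rewrite subrr scale0r addr0 scale1r.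
  have feasS (z w : 'rV[R]_n) (r : R) : P z -> P w -> 0 < r -> r < 1 ->
      forall v, feasible P z v -> feasible P (r *: z + (1 - r) *: w) v.
    move=> Pz Pw r0 r1 v [e e0 Pe]; exists (r * e); first exact: mulr_gt0.
    rewrite addrAC -scalerA -scalerDr.
    have /convex_setP cP := permutahedron_convex.
    by apply: cP => //; apply: ltW.
  move=> xyS; rewrite /tight coord_sumD !coord_sumZ.
  have tx : tight S x.
    by apply: Ax => i j iS jS xij; apply: (xyS i j) => //; apply: feasS.
  have ty : tight S y.
    apply: Ay => i j iS jS yij; apply: (xyS i j) => //.
    by rewrite addrC -{2}(subKr 1 t); apply: feasS => //; lra.
  by rewrite mulrDr !(mulrCA 2) tx ty -mulrDl addrC subrK mul1r.
split; first exact: perm_vertexP.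
move=> hS; apply: vertex_tight => i j iS jS; rewrite ltnNge; apply/negP => ji.
apply: (hS j i) => //; apply: vertex_feasible.
rewrite ltn_neqAle ji andbT; apply: contraNneq jS => /val_inj/perm_inj ->//.
Qed.
(** No index lies outside the full set, so no exchange has to be excluded; the total coordinate sum
    is thus constant on [P]. *)
Lemma tight_setT x : P x -> tight [set: 'I_n]%SET x.
Proof. by move=> Px; apply: feasible_tight => // i j; rewrite inE. Qed.

(** A linear bound valid at both ends of a segment and tight at its midpoint is tight at both
    ends. *)
Lemma tight_midpoint p q S : P p -> P q -> tight S (2^-1 *: (p + q)) ->
  coord_sum S (p - q) = 0.
Proof.
move=> /(coord_sum_ge S) hp /(coord_sum_ge S) hq.
by rewrite /tight coord_sumB coord_sumZ coord_sumD; lra.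
Qed.

Lemma midpoint_in (K : set 'rV[R]_n) p q : @convex_set R 'rV[R]_n K ->
  K p -> K q -> K (2^-1 *: (p + q)).
Proof.
move=> /convex_setP cK Kp Kq.
have -> : 2^-1 *: (p + q) = 2^-1 *: p + (1 - 2^-1) *: q.
  by apply/rowP => i; rewrite !mxE; field.
by apply: cK => //; lra.
Qed.

(* Feasibility of the exchanges e_a - e_b at the midpoint x is a preorder whose
   down-sets are tight, so p - q sums to zero over each of its classes. *)
Lemma exchange p q i : P p -> P q -> 0 < (p - q) 0 i ->
  exists j, [/\ (p - q) 0 j < 0,
    feasible P (2^-1 *: (p + q)) (delta_mx 0 i - delta_mx 0 j) &
    feasible P (2^-1 *: (p + q)) (delta_mx 0 j - delta_mx 0 i)].
Proof.
move=> Pp Pq di; set x := 2^-1 *: (p + q); set d := p - q.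
have cP := permutahedron_convex.
have Px : P x by exact: (midpoint_in cP).
pose r a b := `[< feasible P x (delta_mx 0 a - delta_mx 0 b) >].
have rP a b : reflect (feasible P x (delta_mx 0 a - delta_mx 0 b)) (r a b).
  exact: asboolP.
have rr a : r a a by apply/rP; rewrite subrr; apply: feasible0.
have rt a b c : r a b -> r b c -> r a c.
  move=> /rP ab /rP bc; apply/rP.
  have -> : delta_mx 0 a - delta_mx 0 c =
      (delta_mx 0 a - delta_mx 0 b) + (delta_mx 0 b - delta_mx 0 c) :> 'rV[R]_n.
    by rewrite addrA subrK.
  exact: (feasibleD cP).
(* Reading [r a b] as a preorder, [U] is the down-set of [i] and [W] the part of it strictly below
   [i]. Both are tight at [x], and [U :\: W] is the class of [i]. *)
pose U := [set b | r b i]%SET.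
pose W := [set b in U | ~~ r i b]%SET.
have dU : coord_sum U d = 0.
  apply: tight_midpoint => //; apply: feasible_tight => // a b.
  rewrite !finset.inE => /negP nai bi /rP ab.
  by apply: nai; exact: (rt _ _ _ ab bi).
have dW : coord_sum W d = 0.
  apply: tight_midpoint => //; apply: feasible_tight => // a b.
  rewrite !finset.inE negb_and negbK => nWa /andP[bi nib] /rP ab.
  move: nWa; rewrite (rt _ _ _ ab bi)/= => ia.
  by rewrite (rt _ _ _ ia ab) in nib.
have dUW : \sum_(k in U :\: W) d 0 k = 0.
  have := dU; rewrite /coord_sum (big_setID W)/=.
  rewrite (_ : U :&: W = W)%SET; last first.
    by apply/finset.setIidPr/fintype.subsetP => k /setIdP[].
  by rewrite -/(coord_sum W d) dW add0r.
have iUW : i \in (U :\: W)%SET.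
  by rewrite !finset.inE rr.
(* Over the class of [i] the entries of [d] sum to zero and one of them is positive, so another is
   negative. *)
case: (boolP [exists j in U :\: W, d 0 j < 0]%SET) => [|/exists_inPn d0].
  move=> /exists_inP[j jUW dj]; exists j.
  move: jUW; rewrite !finset.inE negb_and negbK => /andP[+ ji].
  by rewrite ji/= => ij; split=> //; apply/rP.
have := dUW; rewrite (bigD1 i)//= => /eqP; rewrite gt_eqF//.
rewrite ltr_wpDr// sumr_ge0// => k /andP[kUW _].
by rewrite leNgt d0.
Qed.

Definition balance_vector (I J : {set 'I_n}) : 'rV[R]_n :=
  \row_k ((k \in I)%:R - (k \in J)%:R).

Lemma sum_delta_mx (I : {set 'I_n}) k :
  (\sum_(i in I) delta_mx 0 i : 'rV[R]_n) 0 k = (k \in I)%:R.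
Proof.
rewrite summxE; case: (boolP (k \in I)) => kI.
  rewrite (bigD1 k)//= mxE !eqxx big1 ?addr0// => i /andP[_ ik].
  by rewrite mxE eq_sym (negPf ik) andbF.
rewrite big1// => i iI; rewrite mxE andbC.
by case: eqP => // ki; rewrite ki iI in kI.
Qed.

Lemma balance_vectorE (I J : {set 'I_n}) : balance_vector I J =
  \sum_(i in I) delta_mx 0 i - \sum_(j in J) delta_mx 0 j.
Proof. by apply/rowP => k; rewrite !mxE !sum_delta_mx. Qed.

(** Splits a balance vector into exchanges, so that its feasibility can be checked one exchange at a
    time. *)
Lemma balance_vector_image (C : {set 'I_n}) (f : 'I_n -> 'I_n) :
  {in C &, injective f} ->
  balance_vector C (f @: C) = \sum_(i in C) (delta_mx 0 i - delta_mx 0 (f i)).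
Proof. by move=> finj; rewrite balance_vectorE big_imset// sumrB. Qed.

Lemma balance_vectorN (I J : {set 'I_n}) :
  - balance_vector I J = balance_vector J I.
Proof. by apply/rowP => k; rewrite !mxE opprB. Qed.

Lemma balance_vector_neq0 (I J : {set 'I_n}) : I :&: J = finset.set0 ->
  I != finset.set0 -> balance_vector I J != 0.
Proof.
move=> IJ0 /set0Pn[i iI]; apply/eqP => /rowP/(_ i)/eqP; rewrite !mxE iI.
have /negPf -> : i \notin J.
  by apply/negP => iJ; have := finset.in_set0 i; rewrite -IJ0 finset.inE iI iJ.
by rewrite subr0 oner_eq0.
Qed.

Lemma dotv_balance_vector (I J : {set 'I_n}) x :
  dotv (balance_vector I J) x = \sum_(i in I) x 0 i - \sum_(j in J) x 0 j.
Proof.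
rewrite /dotv (eq_bigr _ (fun i _ => congr1 (fun u => u * _) (mxE _ _ _ _))).
under eq_bigr do rewrite mulrBl.
rewrite sumrB; congr (_ - _); rewrite [RHS]big_mkcond; apply: eq_bigr => i _.
  by case: ifP; rewrite ?mul1r ?mul0r.
by case: ifP; rewrite ?mul1r ?mul0r.
Qed.

Lemma dotvZl a x y : dotv (a *: x) y = a * dotv x y.
Proof. by rewrite mulr_sumr; apply: eq_bigr => i _; rewrite mxE mulrA. Qed.

Lemma orthogonal_line (I J : {set 'I_n}) :
  orthogonal_space <[balance_vector I J]>%VS = balance_hyperplane R I J.
Proof.
apply/seteqP; split => x /= xH.
  by apply/eqP; rewrite -subr_eq0 -dotv_balance_vector xH// memv_line.
move=> _ /vlineP[a ->].
by rewrite dotvZl dotv_balance_vector xH subrr mulr0.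
Qed.

End Permutahedron.

(** Take a minimal nonempty subset mapped into itself: its image is again nonempty and mapped into
    itself, hence is all of it. This replaces following an orbit until it closes up. *)
Lemma exists_imset_fixed (T : finType) (A : {set T}) (f : T -> T) :
  A != finset.set0 -> f @: A \subset A ->
  exists C : {set T}, [/\ C != finset.set0, C \subset A & f @: C = C].
Proof.
move=> A0 fA; pose p (C : {set T}) := (C != finset.set0) && (f @: C \subset C).
have [|C /minsetP[/andP[C0 fC] Cmin] CA] := @minset_exists _ p A.
  by rewrite /p A0.
exists C; split=> //; apply: Cmin => //; rewrite /p imsetS// andbT.
by have [c cC] := set0Pn _ C0; apply/set0Pn; exists (f c); apply: imset_f.
Qed.

(** * Every edge of the intersection is parallel to a balance vector *)

Section Edges.
Variables (R : realType) (n : nat).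
Implicit Types (x y z p q v : 'rV[R]_n) (F : set 'rV[R]_n).
Implicit Types (I J : {set 'I_n}) (L : {vspace 'rV[R]_n}).
Local Notation P := (permutahedron R n).
Local Notation Q z := (permutahedron R n `&` reflection z (permutahedron R n)).

Lemma reflectionE K x z : @reflection R n z K x <-> K (2 *: z - x).
Proof.
split=> [[y Ky <-]|Kx]; first by rewrite opprB addrC subrK.
by exists (2 *: z - x) => //; rewrite opprB addrC subrK.
Qed.

Lemma dotvDr (c : 'rV[R]_n) x y : dotv c (x + y) = dotv c x + dotv c y.
Proof. by rewrite -big_split; apply: eq_bigr => i _; rewrite mxE mulrDr. Qed.

Lemma dotvZr (c : 'rV[R]_n) a x : dotv c (a *: x) = a * dotv c x.
Proof. by rewrite mulr_sumr; apply: eq_bigr => i _; rewrite mxE mulrCA. Qed.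

Lemma reflected_convex z : @convex_set R 'rV[R]_n (Q z).
Proof.
have /convex_setP cP := @permutahedron_convex R n.
apply/convex_setP => x y t [Px /reflectionE rx] [Py /reflectionE ry] t0 t1.
split; first exact: cP.
apply/reflectionE.
have -> : 2 *: z - (t *: x + (1 - t) *: y) =
    t *: (2 *: z - x) + (1 - t) *: (2 *: z - y).
  by apply/rowP => i; rewrite !mxE; ring.
exact: cP.
Qed.

(** Moving [x] by [v] moves its reflection by [- v], and both points have to stay in [P]. *)
Lemma feasible_reflected z x v : Q z x -> feasible P x v ->
  feasible P (2 *: z - x) (- v) -> feasible (Q z) x v.
Proof.
have cP := @permutahedron_convex R n.
move=> [Px /reflectionE rx] /(feasible_le cP Px)[e e0 Pe].
move=> /(feasible_le cP rx)[e' e'0 Pe'].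
have m0 : 0 < Num.min e e' by rewrite lt_min e0.
exists (Num.min e e') => //; split.
  by apply: Pe; rewrite ?(ltW m0)// ge_min lexx.
apply/reflectionE; rewrite opprD addrA -scalerN.
by apply: Pe'; rewrite ?(ltW m0)// ge_min lexx orbT.
Qed.

(** A functional maximal at [x] cannot increase along [v] or [- v], so it is constant along [v]. *)
Lemma face_feasible (K F : set 'rV[R]_n) x v : is_face K F -> F x ->
  feasible K x v -> feasible K x (- v) -> feasible F x v.
Proof.
move=> [c ->] [Kx xmax] [e e0 Ke] [e' e'0 Ke'].
have cv : dotv c v = 0.
  have := xmax _ Ke; have := xmax _ Ke'.
  rewrite !dotvDr !dotvZr -scaleN1r dotvZr mulN1r !gerDl.
  rewrite pmulr_rle0// oppr_le0 pmulr_rle0// => h1 h2.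
  by apply/eqP; rewrite eq_le h1 h2.
exists e => //; split=> // y Ky.
by rewrite dotvDr dotvZr cv mulr0 addr0; apply: xmax.
Qed.

Lemma face_convex K F : @convex_set R 'rV[R]_n K -> is_face K F ->
  @convex_set R 'rV[R]_n F.
Proof.
move=> /convex_setP cK [c ->]; apply/convex_setP => x y t [Kx xm] [Ky ym] t0 t1.
split=> [|w Kw]; first exact: cK.
rewrite dotvDr !dotvZr.
have -> : dotv c y = dotv c x by apply/eqP; rewrite eq_le xm// ym.
by rewrite -mulrDl addrC subrK mul1r xm.
Qed.

Lemma direction_unique F L L' : is_direction F L -> is_direction F L' -> L = L'.
Proof.
by move=> [dL mL] [dL' mL']; apply/eqP; rewrite eqEsubv mL// mL'.
Qed.

Lemma direction_points F L : is_direction F L -> L != 0%VS ->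
  exists p q, [/\ F p, F q & p != q].
Proof.
move=> [_ mL] L0; apply: contrapT => Fpq; move/negP: L0; apply.
rewrite -subv0; apply: mL => p q Fp Fq.
rewrite memv0 subr_eq0; apply: contrapT => /negP pq.
by apply: Fpq; exists p, q.
Qed.

(* The exchanges at x and at 2z - x alternate; where they close up into a cycle
   they yield a vector along which one can move both ways inside the edge. *)
Lemma edge_direction z F L : is_edge (Q z) F -> is_direction F L ->
  exists I J, [/\ #|I| = #|J|, I :&: J = finset.set0, I != finset.set0 &
    L = <[balance_vector R I J]>%VS].
Proof.
move=> [faceF [L' dirL']] + dirL; rewrite (direction_unique dirL' dirL) => dimL.
have [|p [q [Fp Fq pq]]] := direction_points dirL.
  by rewrite -dimv_eq0 dimL.
have FQ : F `<=` Q z by case: faceF => c -> w [].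
have [Pp /reflectionE rp] := FQ _ Fp; have [Pq /reflectionE rq] := FQ _ Fq.
set x := 2^-1 *: (p + q); set d := p - q.
have Fx : F x by apply: (midpoint_in (face_convex (@reflected_convex z) faceF)).
have [Px /reflectionE rx] := FQ _ Fx.
(* The reflections of [p] and [q] have midpoint [2 *: z - x] and difference [- d], so [exchange]
   applies there with the signs reversed. *)
have rxE : 2^-1 *: ((2 *: z - p) + (2 *: z - q)) = 2 *: z - x.
  by apply/rowP => i; rewrite !mxE; field.
have rdE i : (2 *: z - p - (2 *: z - q)) 0 i = - d 0 i by rewrite !mxE; ring.
(* [f] leads from positive to negative entries of [d] and [g] back; elsewhere their value is
   arbitrary, here [i] itself. *)
have /choice[f fP] i : exists j, 0 < d 0 i -> [/\ d 0 j < 0,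
    feasible P x (delta_mx 0 i - delta_mx 0 j) &
    feasible P x (delta_mx 0 j - delta_mx 0 i)].
  have [di|] := boolP (0 < d 0 i); last by exists i.
  by have [j jP] := exchange Pp Pq di; exists j.
have /choice[g gP] i : exists j, d 0 i < 0 -> [/\ 0 < d 0 j,
    feasible P (2 *: z - x) (delta_mx 0 i - delta_mx 0 j) &
    feasible P (2 *: z - x) (delta_mx 0 j - delta_mx 0 i)].
  have [di|] := boolP (d 0 i < 0); last by exists i.
  have := @exchange _ _ _ _ i rp rq; rewrite rdE oppr_gt0 rxE => /(_ di)[j].
  by rewrite rdE oppr_lt0 => jP; exists j.
pose A := [set i | 0 < d 0 i]%SET.
(* If no entry of [d] were positive, then [d] would vanish, since its entries sum to zero; but
   [p != q]. *)
have A0 : A != finset.set0.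
  apply/eqP => A0.
  have d0 i : d 0 i <= 0.
    rewrite leNgt; apply/negP => di; have := finset.in_set0 i.
    by rewrite -A0 finset.inE di.
  have /eqP : coord_sum [set: 'I_n]%SET (- d) = 0.
    rewrite -scaleN1r coord_sumZ (tight_midpoint Pp Pq) ?mulr0//.
    exact: tight_setT.
  rewrite psumr_eq0 => [/allP d0'|i _]; last by rewrite mxE oppr_ge0.
  move/negP: pq; apply; rewrite -subr_eq0 -/d; apply/eqP/rowP => i.
  have := d0' i; rewrite mem_index_enum finset.inE mxE oppr_eq0.
  by move=> /(_ isT)/eqP ->; rewrite mxE.
have [|C [C0 CA fgC]] := @exists_imset_fixed _ A (g \o f) A0.
  apply/fintype.subsetP => _ /imsetP[i + ->]; rewrite !finset.inE => /fP[/gP[]].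
  by [].
have Cd i : i \in C -> 0 < d 0 i.
  by move=> /(fintype.subsetP CA); rewrite finset.inE.
have fd i : i \in C -> d 0 (f i) < 0 by move=> /Cd/fP[].
(* A map of a finite set onto itself is injective; this makes [f] injective on [C] and [g] on
   [J]. *)
have hinj : {in C &, injective (g \o f)} by apply/imset_injP; rewrite fgC.
have finj : {in C &, injective f}.
  by move=> i j iC jC fij; apply: hinj => //=; rewrite fij.
pose J := (f @: C)%SET.
have gJ : (g @: J)%SET = C by rewrite /J -imset_comp.
have ginj : {in J &, injective g}.
  by apply/imset_injP; rewrite gJ card_in_imset.
have Jd j : j \in J -> d 0 j < 0 by move=> /imsetP[i /fd + ->].
have CJ0 : C :&: J = finset.set0.
  apply/setP => i; rewrite !finset.inE; apply/negP => /andP[/Cd di /Jd].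
  by rewrite ltNge (ltW di).
exists C, J; split=> //; first by rewrite card_in_imset.
set v := balance_vector R C J.
have cP := @permutahedron_convex R n.
have vE : v = \sum_(i in C) (delta_mx 0 i - delta_mx 0 (f i)).
  exact: balance_vector_image.
have vNE : - v = \sum_(j in J) (delta_mx 0 j - delta_mx 0 (g j)).
  by rewrite balance_vectorN -{1}gJ; apply: balance_vector_image.
(* At [x] the vector [v] is a sum of exchanges along [f]; at the reflection [- v] is a sum of
   exchanges along [g]. All of them are feasible both ways. *)
have xv : feasible P x v.
  by rewrite vE; apply: (feasible_sum cP Px) => i /Cd/fP[].
have xvN : feasible P x (- v).
  rewrite vE -sumrN; apply: (feasible_sum cP Px) => i /Cd/fP[].
  by rewrite opprB.
have rv : feasible P (2 *: z - x) (- v).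
  by rewrite vNE; apply: (feasible_sum cP rx) => i /Jd/gP[].
have rvN : feasible P (2 *: z - x) (- - v).
  rewrite vNE -sumrN; apply: (feasible_sum cP rx) => i /Jd/gP[].
  by rewrite opprB.
have [e e0 Fe] : feasible F x v.
  have Qx := FQ _ Fx.
  by apply: (face_feasible faceF Fx); apply: feasible_reflected.
have vL : v \in L.
  have := dirL.1 _ _ Fe Fx.
  rewrite addrC addKr => /(memvZ e^-1).
  by rewrite scalerA mulVf ?gt_eqF// scale1r.
apply/esym/eqP; rewrite eqEdim dimL dim_vline balance_vector_neq0//=.
by rewrite -memvE vL.
Qed.

Lemma balance_hyperplaneC I J :
  balance_hyperplane R I J = balance_hyperplane R J I.
Proof. by apply/seteqP; split=> x xIJ; apply: esym. Qed.

(** Whichever set contains the minimum of the union is put first. *)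
Lemma exists_D I J : #|I| = #|J| -> I :&: J = finset.set0 ->
  I != finset.set0 -> D n (I, J) \/ D n (J, I).
Proof.
move=> cIJ IJ0 /set0Pn[i0 i0I].
have i0U : i0 \in I :|: J by rewrite finset.inE i0I.
case: (@arg_minnP _ i0 (fun i => i \in I :|: J) (fun i => i : nat) i0U) => m.
rewrite finset.inE => /orP[mI|mJ] mmin; [left|right].
  by split=> //=; exists m.
split=> //=; first by rewrite finset.setIC.
by exists m => // k; rewrite finset.setUC => /mmin.
Qed.

End Edges.

(** * Pairs of permutations that number paired indices consecutively *)

Section PairedPermutations.
Variables (R : realType) (n : nat).
Implicit Types (p q s : seq 'I_n) (v : 'rV[R]_n).
Local Notation vertex := (@perm_vertex R n).

Lemma rank_perm s : uniq s -> (forall i, i \in s) ->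
  exists r : 'S_n, forall i, r i = index i s :> nat.
Proof.
move=> us sT.
have szs : size s = n.
  by rewrite -(card_uniqP us) -[RHS]card_ord; apply: eq_card => i; rewrite sT.
have lts i : (index i s < n)%N by rewrite -{2}szs index_mem.
have finj : injective (fun i => Ordinal (lts i)).
  by move=> i j [] /index_inj; apply.
by exists (perm finj) => i; rewrite permE.
Qed.

(** The entries of a prefix receive the smallest values. *)
Lemma prefix_tight (r : 'S_n) a b : (forall i, r i = index i (a ++ b) :> nat) ->
  tight [set i in a]%SET (vertex r).
Proof.
move=> rE; apply: vertex_tight => i j; rewrite !finset.inE => ia ja.
rewrite !rE !index_cat ia (negPf ja).
by apply: leq_trans (leq_addr _ _); rewrite index_mem.
Qed.

Fixpoint interleave p q : seq 'I_n :=
  match p, q with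
  | a :: p', b :: q' => a :: b :: interleave p' q'
  | _, _ => [::]
  end.

Lemma interleave_cat p1 p2 q1 q2 : size p1 = size q1 ->
  interleave (p1 ++ p2) (q1 ++ q2) = interleave p1 q1 ++ interleave p2 q2.
Proof. by elim: p1 q1 => [|a p1 IH] [|b q1]//= [/IH ->]. Qed.

Lemma perm_interleave p q : size p = size q ->
  perm_eq (interleave p q) (p ++ q).
Proof.
elim: p q => [|a p IH] [|b q]//= [/IH pq].
rewrite perm_cons perm_sym -cat1s perm_catCA/= perm_cons perm_sym.
exact: pq.
Qed.

Lemma index_interleave_l p q k : size p = size q -> k \in p -> k \notin q ->
  index k (interleave p q) = (2 * index k p)%N.
Proof.
elim: p q => [|a p IH] [|b q]//= [/IH pq].
rewrite !in_cons negb_or eq_sym => + /andP[kb kq].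
rewrite [b == k]eq_sym (negPf kb).
by case: eqP => //= _ kp; rewrite pq// mulnS.
Qed.

Lemma index_interleave_r p q k : size p = size q -> k \notin p -> k \in q ->
  index k (interleave p q) = (2 * index k q).+1.
Proof.
elim: p q => [|a p IH] [|b q]//= [/IH pq].
rewrite !in_cons negb_or eq_sym => /andP[/negPf -> kp].
by rewrite eq_sym; case: eqP => //= _ kq; rewrite pq// mulnS.
Qed.

(* The two permutations number p_0, q_0, p_1, q_1, ... and q_0, p_0, q_1, p_1,
   ... consecutively, and then the remaining indices in a common order. *)
Lemma paired_perms p q : size p = size q -> uniq (p ++ q) ->
  exists r r' : 'S_n,
    (forall k, vertex r' 0 k = vertex r 0 k + (k \in p)%:R - (k \in q)%:R) /\
    (forall v, (forall S, tight S (vertex r) -> tight S (vertex r') ->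
        coord_sum S v = 0) ->
      (forall i, i \notin p ++ q -> v 0 i = 0) /\
      (forall i0 m, (m < size p)%N ->
        v 0 (nth i0 p m) + v 0 (nth i0 q m) = 0)).
Proof.
move=> szpq upq.
pose rest := [seq i <- enum 'I_n | i \notin p ++ q].
have upq' : uniq (q ++ p) by rewrite uniq_catC.
have rank_rest p' q' : size p' = size q' -> uniq (p' ++ q') ->
    p' ++ q' =i p ++ q ->
    exists r : 'S_n, forall i, r i = index i (interleave p' q' ++ rest) :> nat.
  move=> sz u pqE; have pe := perm_interleave sz; apply: rank_perm.
    rewrite cat_uniq (perm_uniq pe) u filter_uniq ?enum_uniq// andbT /=.
    apply/hasPn => i; rewrite mem_filter => /andP[+ _].
    by rewrite (perm_mem pe) pqE.
  move=> i; rewrite mem_cat (perm_mem pe) pqE mem_filter mem_enum andbT.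
  exact: orbN.
have [r rE] := rank_rest p q szpq upq (fun=> erefl).
have [|r' r'E] := rank_rest q p (esym szpq) upq'.
  by move=> i; rewrite !mem_cat orbC.
have pe := perm_interleave szpq; have pe' := perm_interleave (esym szpq).
exists r, r'; split=> [k|v v0].
  (* The pair number [m] occupies positions [2m] and [2m + 1] in both numberings, in opposite
     orders: its entry from [p] gains one, its entry from [q] loses one. The other indices keep
     their positions. *)
  rewrite !mxE -!natr1 rE r'E !index_cat (perm_mem pe) (perm_mem pe').
  rewrite (perm_size pe) (perm_size pe') !mem_cat !size_cat.
  have := upq; rewrite cat_uniq => /and3P[_ /hasPn pq _].
  have [kp|kp] := boolP (k \in p); have [kq|kq] := boolP (k \in q) => /=.
  - by have := pq _ kq; rewrite /= kp.
  - rewrite (index_interleave_l szpq)// (index_interleave_r (esym szpq))//.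
    by rewrite -!natr1; ring.
  - rewrite (index_interleave_l (esym szpq))// (index_interleave_r szpq)//.
    by rewrite -!natr1; ring.
  - by rewrite addr0 subr0 (addnC (size q)).
(* Prefixes of the two numberings with the same entries give a set tight at both vertices. Such
   prefixes end after a whole pair or inside [rest]; comparing successive ones isolates a single
   pair or a single remaining index. *)
have prefix0 a a' b b' : interleave p q ++ rest = a ++ b ->
    interleave q p ++ rest = a' ++ b' -> perm_eq a' a ->
    \sum_(i <- a) v 0 i = 0.
  move=> sE s'E a'a.
  have ua : uniq a.
    have : uniq (a ++ b).
      rewrite -sE cat_uniq (perm_uniq pe) upq filter_uniq ?enum_uniq// andbT/=.
      apply/hasPn => i; rewrite mem_filter => /andP[+ _].
      by rewrite (perm_mem pe).
    by rewrite cat_uniq => /andP[].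
  have := v0 [set i in a]%SET.
  rewrite /coord_sum big_set -big_uniq//; apply.
    by apply: (@prefix_tight _ _ b) => i; rewrite rE sE.
  have -> : [set i in a]%SET = [set i in a']%SET.
    by apply/setP => i; rewrite !finset.inE (perm_mem a'a).
  by apply: (@prefix_tight _ _ b') => i; rewrite r'E s'E.
have pairs0 m : (m <= size p)%N ->
    \sum_(i <- take m p) v 0 i + \sum_(i <- take m q) v 0 i = 0.
  move=> mp; have szm : size (take m p) = size (take m q).
    by rewrite !size_take szpq.
  have szd : size (drop m p) = size (drop m q) by rewrite !size_drop szpq.
  have pem := perm_interleave szm.
  rewrite -big_cat -(perm_big _ pem).
  apply: (@prefix0 _ (interleave (take m q) (take m p))
    (interleave (drop m p) (drop m q) ++ rest)
    (interleave (drop m q) (drop m p) ++ rest)).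
  - by rewrite catA -interleave_cat// !cat_take_drop.
  - by rewrite catA -interleave_cat// !cat_take_drop.
  - by rewrite (perm_trans (perm_interleave (esym szm)))// perm_catC perm_sym.
have rest0 m : \sum_(i <- take m rest) v 0 i = 0.
  have := @prefix0 (interleave p q ++ take m rest)
    (interleave q p ++ take m rest) (drop m rest) (drop m rest).
  rewrite -!catA cat_take_drop => /(_ erefl erefl).
  rewrite perm_cat2r big_cat/= (perm_big _ pe) big_cat/=.
  have := pairs0 _ (leqnn _); rewrite {2}szpq !take_size => ->.
  rewrite add0r; apply.
  by rewrite (perm_trans pe')// perm_catC perm_sym.
split=> [i ipq|i0 m mp].
  have ir : i \in rest by rewrite mem_filter ipq mem_enum.
  have := rest0 (index i rest).+1.
  rewrite (take_nth i) ?index_mem// nth_index// -cats1 big_cat/= rest0.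
  by rewrite big_seq1 add0r.
have := pairs0 _ mp.
rewrite (take_nth i0)// (take_nth i0) -?szpq// -!cats1 !big_cat/= !big_seq1.
by rewrite addrACA pairs0 ?add0r// ltnW.
Qed.

End PairedPermutations.

(** * Every balance vector spans the direction of an edge *)

Section BalanceEdges.
Variables (R : realType) (n : nat).
Implicit Types (I J : {set 'I_n}).
Local Notation P := (permutahedron R n).
Local Notation Q z := (permutahedron R n `&` reflection z (permutahedron R n)).

(** Each entry of [w] at [q] is opposite to those at its neighbours in the cyclic sequence p_0, q_0,
    p_1, q_1, ..., so [w] is constant on [p] and takes the opposite value on [q]. *)
Lemma balance_vector_line (p q : seq 'I_n) (w : 'rV[R]_n) :
  size p = size q -> uniq (p ++ q) ->
  (forall i, i \notin p ++ q -> w 0 i = 0) ->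
  (forall i0 m, (m < size p)%N -> w 0 (nth i0 p m) + w 0 (nth i0 q m) = 0) ->
  (forall i0 m, (m < size q)%N ->
    w 0 (nth i0 q m) + w 0 (nth i0 (rot 1 p) m) = 0) ->
  w \in <[balance_vector R [set i in p] [set i in q]]>%VS.
Proof.
case: p => [|i0 p] szpq upq w0 wpq wqp.
  suff -> : w = 0 by rewrite mem0v.
  apply/rowP => i; rewrite mxE w0//.
  by case: q szpq {upq w0 wpq wqp}.
have wp m : (m < size (i0 :: p))%N -> w 0 (nth i0 (i0 :: p) m) = w 0 i0.
  elim: m => // m IH mp; rewrite -(IH (ltnW mp)).
  have h1 := wpq i0 _ (ltnW mp).
  have := wqp i0 m; rewrite -szpq => /(_ (ltnW mp)).
  rewrite rot1_cons nth_rcons (_ : (m < size p)%N)//= => h2.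
  by move: h1 h2; lra.
have wq m : (m < size q)%N -> w 0 (nth i0 q m) = - w 0 i0.
  rewrite -szpq => mp; have := wpq i0 _ mp; rewrite wp// => h; lra.
apply/vlineP; exists (w 0 i0); apply/rowP => i.
have inE s : (i \in [set j in s]%SET) = (i \in s) by rewrite finset.inE.
rewrite !mxE !inE; have := upq; rewrite cat_uniq => /and3P[_ /hasPn pq _].
have [ip|ip] := boolP (i \in i0 :: p).
  have /negPf -> : i \notin q by apply/negP => /pq; rewrite /= ip.
  by rewrite /= subr0 mulr1 -{1}(nth_index i0 ip) wp// index_mem.
have [iq|iq] := boolP (i \in q).
  by rewrite /= sub0r mulrN1 -{1}(nth_index i0 iq) wq// index_mem.
by rewrite /= subr0 mulr0 w0// mem_cat negb_or ip.
Qed.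

Lemma balance_edge I J : #|I| = #|J| -> I :&: J = finset.set0 ->
  I != finset.set0 ->
  exists z F, [/\ P z, is_edge (Q z) F &
    is_direction F <[balance_vector R I J]>%VS].
Proof.
move=> cIJ IJ0 I0; set v := balance_vector R I J.
pose p := enum I; pose q := enum J.
have szpq : size p = size q by rewrite -!cardE.
have szqp : size q = size (rot 1 p) by rewrite size_rot.
have upq : uniq (p ++ q).
  rewrite cat_uniq !enum_uniq andbT/=; apply/hasPn => i.
  rewrite !mem_enum => iJ.
  by apply/negP => iI; have := finset.in_set0 i; rewrite -IJ0 finset.inE iI iJ.
have uqp : uniq (q ++ rot 1 p).
  rewrite uniq_catC (perm_uniq (_ : perm_eq _ (p ++ q)))//.
  by rewrite perm_cat2r perm_rot.
have [r [r' [rr' rv]]] := paired_perms R szpq upq.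
have [s [s' [ss' sv]]] := paired_perms R szqp uqp.
set x := perm_vertex R r in rr' rv; set x' := perm_vertex R r' in rr' rv.
set y := perm_vertex R s in ss' sv; set y' := perm_vertex R s' in ss' sv.
have x'E : x' = x + v.
  by apply/rowP => k; rewrite rr' !mxE !mem_enum addrA.
have y'E : y' = y - v.
  by apply/rowP => k; rewrite ss' !mxE mem_rot !mem_enum; ring.
have [Px Px' Py Py'] : [/\ P x, P x', P y & P y'] by split; exact: perm_vertexP.
(* With this centre the reflection exchanges [x] with [y] and [x' = x + v] with [y' = y - v], so [x]
   and [x'] both lie in [Q z]. *)
pose z := 2^-1 *: (x + y).
have zE : 2 *: z = x + y by rewrite scalerA divff ?scale1r// pnatr_eq0.
have Pz : P z by exact: (midpoint_in (@permutahedron_convex R n)).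
have Qx : Q z x by split=> //; apply/reflectionE; rewrite zE addrC addKr.
have Qx' : Q z x'.
  split=> //; apply/reflectionE; rewrite zE.
  suff -> : x + y - x' = y' by [].
  by rewrite x'E y'E; apply/rowP => i; rewrite !mxE; ring.
(* A boolean form of [tight], so that the sets tight at both [x] and [x'], or at both [y] and [y'],
   can index sums. *)
pose t S (u : 'rV[R]_n) := 2 * coord_sum S u == (#|S| * #|S|.+1)%:R.
pose T1 S := t S x && t S x'; pose T2 S := t S y && t S y'.
have T1x' S : T1 S -> coord_sum S x' = coord_sum S x.
  by move=> /andP[/eqP h /eqP h']; lra.
have T2v S : T2 S -> coord_sum S v = 0.
  move=> /andP[/eqP h /eqP h'].
  by move: h'; rewrite y'E coord_sumB; lra.
have T1_ge u S : Q z u -> T1 S -> coord_sum S x <= coord_sum S u.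
  by move=> [/(coord_sum_ge S) + _] /andP[/eqP h _]; lra.
have T2_le u S : Q z u -> T2 S -> coord_sum S u <= coord_sum S x.
  move=> [_ /reflectionE/(coord_sum_ge S)] + /andP[/eqP h _].
  by rewrite zE coord_sumB coord_sumD; lra.
(* On [Q z] the sum over a set in [T1] is least at [x]; over a set in [T2] it is greatest at [x], by
   reflection. Adding up these bounds gives a functional that is maximal exactly where all of them
   are attained. *)
pose c : 'rV[R]_n :=
  \row_i (\sum_(S | T2 S) (i \in S)%:R - \sum_(S | T1 S) (i \in S)%:R).
have cE u : dotv c u =
    \sum_(S | T2 S) coord_sum S u - \sum_(S | T1 S) coord_sum S u.
  have sumE (T : pred {set 'I_n}) :
      \sum_(i < n) (\sum_(S | T S) (i \in S)%:R) * u 0 i =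
      \sum_(S | T S) coord_sum S u.
    under eq_bigr do rewrite mulr_suml.
    rewrite exchange_big; apply: eq_bigr => S _.
    rewrite /coord_sum [RHS]big_mkcond; apply: eq_bigr => i _.
    by case: ifP; rewrite ?mul1r ?mul0r.
  rewrite -!sumE -sumrB; apply: eq_bigr => i _.
  by rewrite mxE mulrBl.
pose F := [set u | Q z u /\ forall w, Q z w -> dotv c w <= dotv c u].
have c_le u : Q z u -> dotv c u <= dotv c x.
  move=> Qu; rewrite !cE; apply: lerB; apply: ler_sum => S TS.
    exact: T2_le.
  exact: T1_ge.
have Fx : F x by [].
have Fx' : F x'.
  split=> // w Qw; suff -> : dotv c x' = dotv c x by exact: c_le.
  rewrite !cE; congr (_ - _); apply: eq_bigr => S TS; last exact: T1x'.
  by rewrite x'E coord_sumD T2v// addr0.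
have F_line u : F u -> u - x \in <[v]>%VS.
  move=> [Qu /(_ _ Qx)]; rewrite !cE => cxu.
  have h2 S : T2 S -> 0 <= coord_sum S x - coord_sum S u.
    by move=> TS; rewrite subr_ge0 T2_le.
  have h1 S : T1 S -> 0 <= coord_sum S u - coord_sum S x.
    by move=> TS; rewrite subr_ge0 T1_ge.
  have := sumr_ge0 (index_enum _) h2; have := sumr_ge0 (index_enum _) h1.
  rewrite !sumrB => s1 s2.
  (* Two nonnegative sums whose total is at most zero both vanish, and so does each of their
     terms. *)
  have e2 : \sum_(S | T2 S) (coord_sum S x - coord_sum S u) = 0.
    by rewrite sumrB; lra.
  have e1 : \sum_(S | T1 S) (coord_sum S u - coord_sum S x) = 0.
    by rewrite sumrB; lra.
  have [|w0 wpq] := rv (u - x).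
    move=> S /eqP tx /eqP tx'; rewrite coord_sumB.
    by apply: (psumr_eq0P h1 e1); rewrite /T1 /t tx tx'.
  have [|_ wqp] := sv (u - x).
    move=> S /eqP ty /eqP ty'; rewrite coord_sumB -opprB.
    by rewrite (psumr_eq0P h2 e2) ?oppr0// /T2 /t ty ty'.
  have -> : v = balance_vector R [set i in p] [set i in q] by rewrite !set_enum.
  exact: balance_vector_line.
have dirF : is_direction F <[v]>%VS.
  split=> [u w Fu Fw|M FM].
    rewrite (_ : u - w = (u - x) - (w - x)); first by rewrite memvB ?F_line.
    by rewrite opprB addrA subrK.
  have := FM _ _ Fx' Fx.
  by rewrite x'E addrC addKr memvE.
exists z, F; split=> //; split; first by exists c.
by exists <[v]>%VS => //; rewrite dim_vline balance_vector_neq0.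
Qed.

End BalanceEdges.

Theorem theorem3p6 (R : realType) (n : nat) (hn : (1 <= n)%N) :
  fundamental_arrangement (permutahedron R n) =
  [set balance_hyperplane R IJ.1 IJ.2 | IJ in D n].
Proof.
apply/seteqP; split=> [H [z [F [L [Pz edgeF dirL ->]]]]|H [[I J] DIJ <-]].
  have [I [J [cIJ IJ0 I0 ->]]] := edge_direction edgeF dirL.
  rewrite orthogonal_line; case: (exists_D cIJ IJ0 I0) => DIJ.
    by exists (I, J).
  by exists (J, I) => //; rewrite balance_hyperplaneC.
have [I0 _] := D_neq0 DIJ; case: DIJ => /= cIJ IJ0 _.
have [z [F [Pz edgeF dirF]]] := balance_edge R cIJ IJ0 I0.
by exists z, F, <[balance_vector R I J]>%VS; split; rewrite ?orthogonal_line.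
Qed.
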